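(* Let $F$ be a social choice set and let $\mathcal{S}=(R,E)$ be a solution concept. Let $\Gamma^F$ be the class of all mechanisms that fully implement $F$ in $\mathcal{S}$. (i) If $F$ is fully implementable in $\mathcal{S}$ and $\mathcal{S}$ satisfies Weak Solution Consistency (WSC), then for all $i\in I$ and $t_i\in T_i$ there exists $f^{i,t_i}\in F$ that is Bayesian Incentive Compatible (BIC) for agent $i$ and type $t_i$. (ii) Conversely, if $F$ is fully implementable in $\mathcal{S}$ and for all $i\in I$ and $t_i\in T_i$ there exists $f^{i,t_i}\in F$ that is BIC for $i$ and $t_i$, then $\mathcal{S}$ satisfies WSC for $\Gamma^F$.
   Context: Environment. $I$ is the set of agents, $A$ the set of alternatives, $T_i$ the set of types of agent $i$, $T=\times_{i\in I}T_i$, $T_{-i}=\times_{j\neq i}T_j$. The spaces $A$, $T_i$ and all action sets $S_i$ below are separable metrizable with Borel $\sigma$-algebras, and products carry the product topology. Type $t_i$ of agent $i$ has a belief $p_i(\cdot|t_i)\in\Delta(T_{-i})$ with full support. Bernoulli utilities $u_i:A\times T\to\mathbb{R}$ are bounded and continuous; for a lottery $a\in\Delta(A)$, $u_i(a,t)$ denotes expected utility. Social choice and mechanisms. A social choice function (SCF) is a measurable $f:T\to\Delta(A)$; a social choice set is a nonempty set $F$ of SCFs. A mechanism is a pair $\gamma=(\mu,S)$ with $S=\times_{i\in I}S_i$ and $\mu:S\to\Delta(A)$ measurable; $\Gamma$ is the class of all mechanisms. Given $\gamma$, $\Sigma$ is the set of strategy profiles, i.e. measurable $\sigma:T\to\Delta(S)$;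 $\Sigma_{-i}$ is the set of measurable $\sigma_{-i}:T_{-i}\to\Delta(S_{-i})$. $\mu(\sigma(t))\in\Delta(A)$ is the lottery induced by $\sigma(t)$ under $\mu$, and $\mu(\sigma)$ is the SCF $t\mapsto\mu(\sigma(t))$. Solution concepts. An expectation profile for $\gamma$ is $e=(e_i)_{i\in I}$ with $e_i:T_i\to\Sigma_{-i}$, $t_i\mapsto e_{i,t_i}$. A theory of expectations $E$ assigns to each mechanism $\gamma$ a set $E(\gamma)$ of expectation profiles for $\gamma$. A theory of response $R$ assigns to each mechanism $\gamma$ and each $e\in E(\gamma)$ a set $R(e)\subseteq\Sigma$. A solution concept is a pair $\mathcal{S}=(R,E)$; its set of solutions to $\gamma$ is $\mathcal{S}(\gamma)=\bigcup_{e\in E(\gamma)}R(e)$. Full implementation. A mechanism $\gamma=(\mu,S)$ fully implements $F$ in $\mathcal{S}$ if $\{\mu(\sigma):\sigma\in\mathcal{S}(\gamma)\}=F$ and $R(e)\neq\emptyset$ for all $e\in E(\gamma)$. $F$ is fully implementable in $\mathcal{S}$ if $\Gamma^F\neq\emptyset$. BIC. An SCF $f$ is BIC for agent $i$ and type $t_i$ if for all $t_i'\in T_i$, $\int_{T_{-i}}u_i(f(t),t)\,dp_i(t_{-i}|t_i)\geq\int_{T_{-i}}u_i(f(t_i',t_{-i}),t)\,dp_i(t_{-i}|t_i)$, where $t=(t_i,t_{-i})$. WSC. $\mathcal{S}$ satisfies WSC for a class $\tilde\Gamma\subseteq\Gamma$ if for all $\gamma\in\tilde\Gamma$, $i\in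 I$, $t_i\in T_i$ there exists $\sigma\in\mathcal{S}(\gamma)$ such that for all $t_i'\in T_i$: $\int_{T_{-i}}u_i(\mu(\sigma(t)),t)\,dp_i(t_{-i}|t_i)\geq\int_{T_{-i}}u_i(\mu(\sigma(t_i',t_{-i})),t)\,dp_i(t_{-i}|t_i)$. $\mathcal{S}$ satisfies WSC if it satisfies WSC for the class of all $\gamma\in\Gamma$ with $\mathcal{S}(\gamma)\neq\emptyset$. *)

(* Defs.v *)
From HB Require Import structures.
From mathcomp Require Import all_boot all_order all_algebra.
From mathcomp Require Import all_classical all_reals all_analysis.
From mathcomp Require Import measurable_realfun.

Set Implicit Arguments.
Unset Strict Implicit.
Unset Printing Implicit Defensive.

Import Order.TTheory GRing.Theory Num.Theory.
Import numFieldNormedType.Exports.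

Local Open Scope classical_set_scope.
Local Open Scope ring_scope.

Definition separable (X : topologicalType) :=
  exists2 D : set X, countable D & dense D.

Definition metrizable (R : realType) (X : topologicalType) :=
  exists d : X -> X -> R,
    [/\ forall x y, d x y = 0 <-> x = y,
        forall x y, d x y = d y x,
        forall x y z, d x z <= d x y + d y z
      & forall x U, nbhs x U <->
          exists2 e, 0 < e & [set y | d x y < e] `<=` U].

(* Spaces are pointed, i.e. nonempty, because measurableType requires it. *)
Definition borel (X : ptopologicalType) : measurableType (@open X).-sigma :=
  g_sigma_algebraType (@open X).

(* The sigma-algebra of [pprobability (borel X) R] is generated by the
   evaluations at the Borel sets; for X separable metrizable it is the Borel
   sigma-algebra of the topology of weak convergence. *)
Definition Delta (R : realType) (X : ptopologicalType) :
  measurableType (@pset _ (borel X) R).-sigma := pprobability (borel X) R.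

Definition law (R : realType) (X : ptopologicalType) (P : Delta R X) :
  probability (borel X) R := P.

(* On a separable metrizable space, the smallest closed set of measure 1. *)
Definition support_of (R : realType) (X : ptopologicalType)
    (P : Delta R X) : set X :=
  \bigcap_(C in [set C : set X | closed C /\ law P C = 1%E]) C.

Definition full_support (R : realType) (X : ptopologicalType)
    (P : Delta R X) := support_of P = [set: X].

Section mixture.
Context (R : realType) (X Y : ptopologicalType).
Variable k : {mfun borel X >-> Delta R Y}.
Local Open Scope ereal_scope.

(* The law in [Delta R Y] of the output of [k] when its input has law [P]. *)
Definition mixture (P : Delta R X) (B : set (borel Y)) : \bar R :=
  \int[law P]_x law (k x) B.

Let k_kernel : R.-pker (borel X) ~> (borel Y) :=
  kprobability (measurable_funPT k).

Let mk B : measurable B ->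
  measurable_fun [set: borel X] (fun x => law (k x) B).
Proof. by move=> mB; exact: (measurable_kernel k_kernel B mB). Qed.

Section mixture_measure.
Variable P : Delta R X.

Let mixture0 : mixture P set0 = 0.
Proof. by apply: integral0_eq => x _; rewrite measure0. Qed.

Let mixture_ge0 B : 0 <= mixture P B.
Proof. exact: integral_ge0. Qed.

Let mixture_sigma_additive : semi_sigma_additive (mixture P).
Proof.
move=> F mF tF mUF; rewrite [X in _ --> X](_ : _ =
  \int[law P]_x
    (\sum_(n <oo) law (k x) (F n))); last first.
  apply: eq_integral => x _.
  by apply/esym/cvg_lim => //; exact/measure_semi_sigma_additive.
apply/cvg_closeP; split.
  by apply: is_cvg_nneseries => n _ _; exact: integral_ge0.
by rewrite closeE// integral_nneseries// => n; exact: mk.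
Qed.

HB.instance Definition _ := isMeasure.Build _ (borel Y) R (mixture P)
  mixture0 mixture_ge0 mixture_sigma_additive.

Let mixture_setT : mixture P [set: borel Y] = 1.
Proof.
rewrite /mixture; under eq_integral do rewrite probability_setT.
by rewrite integral_cst//= probability_setT mule1.
Qed.

HB.instance Definition _ := Measure_isProbability.Build _ (borel Y) R
  (mixture P) mixture_setT.

Definition mixture_law : Delta R Y := (mixture P : probability (borel Y) R).

End mixture_measure.

Lemma measurable_mixture_law (Z : ptopologicalType)
    (s : {mfun borel Z >-> Delta R X}) :
  measurable_fun [set: borel Z] (fun z => mixture_law (s z)).
Proof.
apply: (measurability (@pset _ _ _ : set (set (pprobability (borel Y) R)))) => //.
move=> _ -[_ [r r01] [B mB <-]] <-.
apply: emeasurable_fun_infty_o => //.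
apply: (@measurable_fun_integral_kernel _ _ (borel Z) (borel X) R
  (kprobability (measurable_funPT s))) => //.
- by move=> U mU; exact: (@measurable_kernel _ _ _ _ _
    (kprobability (measurable_funPT s)) U mU).
- exact: mk.
Qed.

End mixture.

HB.instance Definition _ (I : Type) (X : I -> ptopologicalType) :=
  Pointed.copy (prod_topology X) (forall i, X i).

Section profiles.
Context (I : eqType) (X : I -> ptopologicalType).

Definition profile : ptopologicalType := prod_topology X.

Definition others_profile (i : I) : ptopologicalType :=
  prod_topology (fun j : {j : I | j != i} => X (val j)).

(* The profile (x_i, x_(-i)). *)
Definition extend (i : I) (xi : X i) (x : others_profile i) : profile :=
  fun j => match j =P i with
           | ReflectT e => ecast k (X k) (esym e) xi
           | ReflectF ne => x (exist _ j (introN eqP ne))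
           end.

End profiles.

Record environment (R : realType) := Environment {
  agent : eqType;
  alternative : ptopologicalType;
  agent_type : agent -> ptopologicalType;
  alternative_separable : separable alternative;
  alternative_metrizable : metrizable R alternative;
  agent_type_separable : forall i, separable (agent_type i);
  agent_type_metrizable : forall i, metrizable R (agent_type i);
  belief : forall i, agent_type i -> Delta R (others_profile agent_type i);
  belief_full_support : forall i (ti : agent_type i), full_support (belief ti);
  utility : agent -> alternative * profile agent_type -> R;
  utility_bounded : forall i, exists M : R, forall x, `|utility i x| <= M;
  utility_continuous : forall i, continuous (utility i)
}.

Section definitions.
Context (R : realType) (env : environment R).
Let I := agent env.
Let A := alternative env.
Let T := profile (@agent_type R env).

Definition scf := {mfun borel T >-> Delta R A}.

Definition expected_utility (i : I) (a : Delta R A) (t : T) : R :=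
  \int[law a]_x utility i (x, t).

(* Expected payoff of type ti reporting ti' when the others report
   truthfully and lotteries are selected according to g. *)
Definition interim_payoff (i : I) (ti : agent_type i) (g : T -> Delta R A)
    (ti' : agent_type i) : R :=
  \int[law (belief ti)]_t
     expected_utility i (g (extend ti' t)) (extend ti t).

Definition BIC_at (f : scf) (i : I) (ti : agent_type i) :=
  forall ti', interim_payoff ti f ti' <= interim_payoff ti f ti.

Record mechanism := Mechanism {
  action : I -> ptopologicalType;
  action_separable : forall i, separable (action i);
  action_metrizable : forall i, metrizable R (action i);
  mechanism_map : {mfun borel (profile action) >-> Delta R A}
}.

Definition strategy_profile (m : mechanism) :=
  {mfun borel T >-> Delta R (profile (action m))}.

Definition others_strategy_profile (m : mechanism) (i : I) :=
  {mfun borel (others_profile (@agent_type R env) i) >->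
        Delta R (others_profile (action m) i)}.

Definition lottery (m : mechanism) (P : Delta R (profile (action m))) :
  Delta R A := mixture_law (mechanism_map m) P.
Arguments lottery : clear implicits.

Definition outcome_fun (m : mechanism) (s : strategy_profile m) (t : T) :
  Delta R A := lottery m (s t).

Lemma measurable_outcome_fun (m : mechanism) (s : strategy_profile m) :
  measurable_fun [set: borel T] (outcome_fun s).
Proof. exact: measurable_mixture_law. Qed.

Definition outcome (m : mechanism) (s : strategy_profile m) : scf :=
  mfun_Sub (mem_set (measurable_outcome_fun s)).

Definition expectation_profile (m : mechanism) :=
  forall i : I, agent_type i -> others_strategy_profile m i.

Record solution_concept := SolutionConcept {
  expectations : forall m : mechanism, set (expectation_profile m);
  responses : forall (m : mechanism) (e : expectation_profile m),
    expectations e -> set (strategy_profile m)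
}.

Definition solutions (S : solution_concept) (m : mechanism) :
    set (strategy_profile m) :=
  [set s | exists (e : expectation_profile m) (he : expectations S e),
             responses he s].
Arguments solutions : clear implicits.

(* A [probability] also has (meaningless) values on non-measurable sets, so two
   lotteries are identified when they agree on Borel sets. *)
Definition scf_eq (f g : scf) :=
  forall t (B : set (borel A)), measurable B ->
    law (f t) B = law (g t) B.

Definition fully_implements (S : solution_concept) (F : set scf)
    (m : mechanism) :=
  [/\ forall s, solutions S m s -> exists2 f, F f & scf_eq (outcome s) f,
      forall f, F f -> exists2 s, solutions S m s & scf_eq (outcome s) f
    & forall (e : expectation_profile m) (he : expectations S e),
        responses he !=set0].

Definition fully_implementable (S : solution_concept) (F : set scf) :=
  exists m, fully_implements S F m.

Definition WSC_for (S : solution_concept) (G : mechanism -> Prop) :=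
  forall m, G m -> forall (i : I) (ti : agent_type i),
  exists2 s, solutions S m s &
    forall ti', interim_payoff ti (fun t => lottery m (s t)) ti' <=
                interim_payoff ti (fun t => lottery m (s t)) ti.

Definition WSC (S : solution_concept) :=
  WSC_for S (fun m => solutions S m !=set0).

End definitions.

(* Main.v *)
(* The WSC inequality for a solution s is, by conversion, BIC of the SCF that s
   induces; full implementation identifies the SCFs induced by solutions with
   the members of F, up to agreement on Borel sets, and interim payoffs only
   see the values of lotteries on Borel sets. *)
Require Import Defs.
From mathcomp Require Import all_boot all_order all_algebra.
From mathcomp Require Import all_classical all_reals all_analysis.
Local Open Scope classical_set_scope.

Lemma interim_payoff_scf_eq {R : realType} {env : environment R}
    {f g : scf env} {i : agent env} (ti ti' : agent_type i) :
  scf_eq f g -> interim_payoff ti f ti' = interim_payoff ti g ti'.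
Proof.
move=> fg; apply: eq_Rintegral => t _.
(* Lotteries that agree on Borel sets need not be equal as terms, so the integrals are compared
   through their measures, as extended reals under [fine]. *)
rewrite /expected_utility /Rintegral; congr fine.
by apply: eq_measure_integral => B mB _; exact: fg.
Qed.

Lemma BIC_at_scf_eq {R : realType} {env : environment R}
    {f g : scf env} {i : agent env} (ti : agent_type i) :
  scf_eq f g -> BIC_at f ti <-> BIC_at g ti.
Proof.
move=> fg; split=> bic ti'; have := bic ti';
  by rewrite !(interim_payoff_scf_eq _ _ fg).
Qed.

Theorem theorem3 (R : realType) (env : environment R) (F : set (scf env))
    (F_nonempty : F !=set0) (S : solution_concept env) :
  (fully_implementable S F -> WSC S ->
     forall (i : agent env) (ti : agent_type i),
       exists2 f, F f & BIC_at f ti) /\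
  (fully_implementable S F ->
     (forall (i : agent env) (ti : agent_type i),
        exists2 f, F f & BIC_at f ti) ->
     WSC_for S (fully_implements S F)).
Proof.
split=> [[m [SF FS _]] wsc i ti|_ bic m [SF FS _] i ti].
(* A member of [F] provides a solution of [m], which [WSC] requires of the mechanisms it covers. *)
- have [f Ff] := F_nonempty.
  have [s0 ms0 _] := FS f Ff.
  have [s ms bic_s] := wsc m (ex_intro _ s0 ms0) i ti.
  have [g Fg sg] := SF s ms.
  exists g; [exact: Fg | exact: (BIC_at_scf_eq ti sg).1 bic_s].
- have [f Ff bic_f] := bic i ti.
  (* A solution inducing [f] up to [scf_eq] is the witness at [i] and [ti]. *)
  have [s ms sf] := FS f Ff.
  have bic_s : BIC_at (outcome s) ti := (BIC_at_scf_eq ti sf).2 bic_f.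
  exists s; [exact: ms | exact: bic_s].
Qed.
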